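(* Let $1 < p \leq n$ and let $\Omega \subset \mathbb{R}^n$ be a bounded domain satisfying the exterior sphere condition with a fixed radius $R > 0$. For $x \in \Omega$ let $\delta(x) = \min_{\xi \in \partial\Omega} |x - \xi|$. Then there exists a finite constant $C_\Omega$, independent of $\zeta$, such that $$\int_{\Omega} \left|\frac{\zeta(x)}{\delta(x)}\right|^{p} dx \leq C_{\Omega} \int_{\Omega} |\nabla \zeta(x)|^{p}\, dx$$ holds for all $\zeta \in C^{\infty}_{0}(\Omega)$.
   Context: A domain is a nonempty connected open subset of $\mathbb{R}^n$. $C^\infty_0(\Omega)$ denotes the real-valued smooth functions with compact support in $\Omega$. $|\cdot|$ is the Euclidean norm and $dx$ is Lebesgue measure. The domain $\Omega$ satisfies the exterior sphere condition with radius $R$ if for every $\xi \in \partial\Omega$ there is a point $y \in \mathbb{R}^n$ with $|y - \xi| = R$ and $\mathrm{dist}(y, \overline{\Omega}) \geq R$ (that is, the open ball of radius $R$ centered at $y$ does not meet $\overline{\Omega}$ and its boundary sphere passes through $\xi$). *)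

(* Defs.v *)
From HB Require Import structures.
From mathcomp Require Import all_boot all_order all_algebra.
From mathcomp Require Import all_classical all_reals all_analysis.
Import Order.TTheory GRing.Theory Num.Theory.
Import numFieldNormedType.Exports.

Set Implicit Arguments.
Unset Strict Implicit.
Unset Printing Implicit Defensive.

Local Open Scope classical_set_scope.
Local Open Scope ring_scope.

(* ['rV[R]_n] carries the sigma-algebra generated by its coordinates, as
   [n.-tuple R] does in the library; it is the Borel sigma-algebra of R^n. *)
Section measurable_rV.
Context {R : realType} (n : nat).

Definition rV_coord (i : 'I_n) (x : 'rV[R]_n) : measurableTypeR R := x ord0 i.

Let rV_set0 : g_sigma_preimage rV_coord set0.
Proof. exact: sigma_algebra0. Qed.

Let rV_setC A : g_sigma_preimage rV_coord A -> g_sigma_preimage rV_coord (~` A).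
Proof. exact: sigma_algebraC. Qed.

Let rV_bigcup (F : (set 'rV[R]_n)^nat) :
  (forall i, g_sigma_preimage rV_coord (F i)) ->
  g_sigma_preimage rV_coord (\bigcup_i (F i)).
Proof. exact: sigma_algebra_bigcup. Qed.

HB.instance Definition _ := @isMeasurable.Build default_measure_display
  'rV[R]_n (g_sigma_preimage rV_coord) rV_set0 rV_setC rV_bigcup.

End measurable_rV.

Section lebesgue_measure_rV.
Context {R : realType}.

Lemma measurable_rV_coord n (i : 'I_n) :
  measurable_fun [set: 'rV[R]_n] (rV_coord i).
Proof.
move=> _ Y mY; rewrite setTI; apply: sub_sigma_algebra => /=.
rewrite -bigcup_seq/=; exists i => /=; first by rewrite mem_index_enum.
by exists Y => //; rewrite setTI.
Qed.

Lemma measurable_rVP d (T : measurableType d) n (f : T -> 'rV[R]_n) :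
  (forall i, measurable_fun setT (rV_coord i \o f)) -> measurable_fun setT f.
Proof.
move=> mf.
have : g_sigma_preimage (fun i => rV_coord i \o f) `<=` measurable.
  apply: smallest_sub; first exact: sigma_algebra_measurable.
  case: n => [|n] in f mf *; first by rewrite big_ord0.
  rewrite -bigcup_mkord_ord; apply: bigcup_sub => i Ii.
  by move=> A [B mB <-]; exact: mf.
by rewrite g_sigma_preimage_comp => prefS _ A mA; apply: prefS; exists A.
Qed.

Definition rV_cons n (z : measurableTypeR R * 'rV[R]_n) : 'rV[R]_n.+1 :=
  row_mx (z.1 : R)%:M z.2.

Lemma rV_cons0 n (z : measurableTypeR R * 'rV[R]_n) :
  rV_cons z ord0 ord0 = z.1.
Proof.
rewrite mxE; case: splitP => [k _|k]; first by rewrite !ord1 mxE.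
by move=> /eqP; rewrite eq_sym addnC addn1.
Qed.

Lemma rV_consS n (z : measurableTypeR R * 'rV[R]_n) i :
  rV_cons z ord0 (lift ord0 i) = z.2 ord0 i.
Proof.
rewrite mxE; case: splitP => [k|k [] /val_inj ->//].
by rewrite ord1.
Qed.

Lemma measurable_rV_cons n : measurable_fun setT (@rV_cons n).
Proof.
apply: measurable_rVP => i; case: (unliftP ord0 i) => [j ->|->].
  rewrite (_ : _ \o _ = rV_coord j \o snd).
    by apply: measurableT_comp => //; exact: measurable_rV_coord.
  by apply/funext => z /=; exact: rV_consS.
rewrite (_ : _ \o _ = fst) //.
by apply/funext => z /=; exact: rV_cons0.
Qed.

#[local] Hint Extern 0 (measurable_fun _ (@rV_cons _)) =>
  solve [apply: measurable_rV_cons] : core.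

Section lebesgue_step.
Variables (n : nat) (m : {sigma_finite_measure set 'rV[R]_n -> \bar R}).

Definition lebesgue_step : set 'rV[R]_n.+1 -> \bar R :=
  pushforward (@lebesgue_measure R \x m)%E (@rV_cons n).

Let lebesgue_step0 : lebesgue_step set0 = 0%E.
Proof. exact: measure0. Qed.

Let lebesgue_step_ge0 A : (0 <= lebesgue_step A)%E.
Proof. exact: measure_ge0. Qed.

Let lebesgue_step_sigma_additive : semi_sigma_additive lebesgue_step.
Proof. exact: measure_semi_sigma_additive. Qed.

HB.instance Definition _ := isMeasure.Build _ _ _ lebesgue_step
  lebesgue_step0 lebesgue_step_ge0 lebesgue_step_sigma_additive.

Let rV_uncons (x : 'rV[R]_n.+1) : measurableTypeR R * 'rV[R]_n :=
  (x ord0 ord0, \row_i x ord0 (lift ord0 i)).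

Let rV_consK : cancel (@rV_cons n) rV_uncons.
Proof.
move=> -[a v]; rewrite /rV_uncons rV_cons0/=; congr pair.
by apply/rowP => i; rewrite mxE rV_consS.
Qed.

Let rV_unconsK : cancel rV_uncons (@rV_cons n).
Proof.
move=> x; apply/rowP => i; case: (unliftP ord0 i) => [j ->|->].
  by rewrite rV_consS mxE.
by rewrite rV_cons0.
Qed.

Let measurable_rV_uncons : measurable_fun setT rV_uncons.
Proof.
apply: measurable_fun_pair; first exact: (measurable_rV_coord ord0).
apply: measurable_rVP => i.
rewrite (_ : _ \o _ = rV_coord (lift ord0 i)); first exact: measurable_rV_coord.
by apply/funext => x /=; rewrite /rV_coord mxE.
Qed.

Let lebesgue_step_sigma_finite : sigma_finite setT lebesgue_step.
Proof.
have /sigma_finiteP[F [TF ndF Foo]] := sigma_finiteT (@lebesgue_measure R).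
have /sigma_finiteP[G [TG ndG Goo]] := sigma_finiteT m.
exists (fun k => rV_uncons @^-1` (F k `*` G k)).
  rewrite -preimage_bigcup (_ : \bigcup_k _ = setT) ?preimage_setT//.
  apply/seteqP; split => // -[x y] _.
  have [k _ Fkx] : (\bigcup_k F k) x by rewrite -TF.
  have [l _ Gly] : (\bigcup_k G k) y by rewrite -TG.
  exists (maxn k l) => //; split => /=.
    by move: x Fkx; exact/subsetPset/ndF/leq_maxl.
  by move: y Gly; exact/subsetPset/ndG/leq_maxr.
move=> k; have [mF Fk] := Foo k; have [mG Gk] := Goo k; split.
  rewrite -[X in measurable X]setTI.
  by apply: measurable_rV_uncons => //; exact: measurableX.
rewrite /lebesgue_step /pushforward -comp_preimage.
rewrite (_ : _ \o _ = id); last by apply/funext => z /=; rewrite rV_consK.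
by rewrite preimage_id product_measure1E// lte_mul_pinfty// ge0_fin_numE.
Qed.

HB.instance Definition _ := Measure_isSigmaFinite.Build _ _ _ lebesgue_step
  lebesgue_step_sigma_finite.

End lebesgue_step.

(* n-dimensional Lebesgue measure, as an iterated product measure; it is
   characterized by [lebesgue_rV_box] below. *)
Fixpoint lebesgue_rV n : {sigma_finite_measure set 'rV[R]_n -> \bar R} :=
  match n with
  | 0 => [the {sigma_finite_measure set 'rV[R]_0 -> \bar R} of
            dirac (0 : 'rV[R]_0)]
  | n'.+1 => [the {sigma_finite_measure set 'rV[R]_n'.+1 -> \bar R} of
            lebesgue_step (lebesgue_rV n')]
  end.

Lemma measurable_rV_box n (A : 'I_n -> set (measurableTypeR R)) :
  (forall i, measurable (A i)) ->
  measurable [set x : 'rV[R]_n | forall i, A i (x ord0 i)].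
Proof.
move=> mA.
rewrite (_ : [set _ | _] = \bigcap_(i in [set: 'I_n]) (rV_coord i @^-1` A i)).
  apply: fin_bigcap_measurable => // i _.
  by rewrite -[X in measurable X]setTI; apply: measurable_rV_coord.
by apply/seteqP; split => [x Ax i _|x Ax i]; [exact: Ax|exact: Ax].
Qed.

Lemma lebesgue_rV_box n (A : 'I_n -> set (measurableTypeR R)) :
  (forall i, measurable (A i)) ->
  lebesgue_rV n [set x : 'rV[R]_n | forall i, A i (x ord0 i)] =
  (\prod_(i < n) lebesgue_measure (A i))%E.
Proof.
elim: n A => [|n IHn] A mA.
  rewrite big_ord0 /= diracE (_ : [set _ | _] = setT) ?in_setT//.
  by apply/seteqP; split => // x _ [].
rewrite big_ord_recl /= -(IHn _ (fun i => mA (lift ord0 i))).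
have mAS := measurable_rV_box (fun i => mA (lift ord0 i)).
rewrite -product_measure1E//.
rewrite /lebesgue_step /pushforward; congr (_ _).
apply/seteqP; split => [z /= Az|z /= [Az0 AzS] i].
  split; first by have := Az ord0; rewrite rV_cons0.
  by move=> i; have := Az (lift ord0 i); rewrite rV_consS.
by case: (unliftP ord0 i) => [j ->|->]; rewrite ?rV_cons0 ?rV_consS.
Qed.

End lebesgue_measure_rV.

Section euclidean.
Context {R : realType} (n : nat).
Implicit Types (x y : 'rV[R]_n) (A : set 'rV[R]_n) (f : 'rV[R]_n -> R).

(* The library norm on ['rV[R]_n] is the sup norm, with the same topology. *)
Definition enorm x : R := Num.sqrt (\sum_(i < n) x ord0 i ^+ 2).

(* A minimum whenever [A] is closed and nonempty; [inf] is 0 on the empty set. *)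
Definition dist x A : R := inf [set enorm (x - y) | y in A].

Definition boundary A := closure A `\` A^°.

Definition domain A := [/\ A !=set0, connected A & open A].

Definition exterior_sphere (r : R) A := forall xi, boundary A xi ->
  exists y, enorm (y - xi) = r /\ r <= dist y (closure A).

Definition partial (i : 'I_n) f : 'rV[R]_n -> R := 'D_(delta_mx ord0 i) f.

Definition grad f x : 'rV[R]_n := \row_i partial i f x.

(* [s] lists the indices of an iterated partial derivative. *)
Definition smooth f := forall s : seq 'I_n,
  let g := foldr partial f s in
  continuous g /\ forall i x, derivable g x (delta_mx ord0 i).

(* Functions in C_0^oo(A) are extended by 0 to the whole space. *)
Definition test_function A f := [/\ smooth f,
  compact (closure [set x | f x != 0]) & closure [set x | f x != 0] `<=` A].

End euclidean.

(* Main.v *)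
Require Import Defs.
From mathcomp Require Import all_boot all_order all_algebra.
From mathcomp Require Import all_classical all_reals all_analysis.
From mathcomp Require Import measurable_realfun ring lra.
Import Order.TTheory GRing.Theory Num.Theory.
Import numFieldNormedType.Exports.
Local Open Scope classical_set_scope.
Local Open Scope ring_scope.

Set Implicit Arguments.
Unset Strict Implicit.
Unset Printing Implicit Defensive.

(** The inequality comes from one-dimensional estimates along the coordinate
    axes. If [x] is at distance [d] of a boundary point [xi] and [B] is an
    exterior ball touching at [xi], the centre of [B] is within [r + d] of [x],
    and one of its coordinates differs from that of [x] by at least a fraction
    [1 / n] of their distance. For small [d], moving along this axis by a
    multiple of [d] therefore enters [B]; for large [d], boundedness of the
    domain suffices. Hence every [x] of the domain leaves it along some axis [i]
    at a parameter [t] with [|t| <= K * dist x (boundary Omega)]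
    ([exterior_sphere_exit]). Since [zeta] vanishes at the exit point,
    [|zeta x| / dist] is at most [K] times the difference quotient of [zeta]
    between [x] and that point, hence at most [K] times the supremum of all
    difference quotients of [zeta] at [x] in the direction [i].

    On a line, the supremum of the difference quotients of [g] is at most four
    times the Hardy-Littlewood maximal function of the derivative of [g], so its
    [L^p] norm is controlled by that of the derivative
    ([slope_sup_inequality]). This is the strong maximal inequality, which holds
    for [p > 1]; it follows from the weak-type inequality applied, at each level,
    to the part of the function above half of that level.

    Tonelli's theorem transfers the bound to every axis of the space
    ([le_integral_lines], [axis_slope_sup_inequality]); summing over the axes
    gives the theorem. Suprema are taken over rational increments, which makes
    them measurable and loses nothing for a continuous function
    ([slope_le_slope_sup]). *)

(** * The Hardy-Littlewood maximal function on the line *)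

(** The integral of a nonnegative function is monotone even when the functions
    are not measurable: it is a supremum over the simple functions below. *)
Lemma ge0_le_integral_nonmeasurable d (T : measurableType d) (R : realType)
    (mu : {measure set T -> \bar R}) (D : set T) (f g : T -> \bar R) :
  (forall x, D x -> 0 <= f x)%E -> (forall x, D x -> f x <= g x)%E ->
  (\int[mu]_(x in D) f x <= \int[mu]_(x in D) g x)%E.
Proof.
move=> f0 fg; rewrite (integral_mkcond D f) (integral_mkcond D g).
have pf0 x : (0 <= (f \_ D) x)%E.
  by rewrite patchE; case: ifPn => // /set_mem; exact: f0.
have pfg x : ((f \_ D) x <= (g \_ D) x)%E.
  by rewrite !patchE; case: ifPn => // /set_mem; exact: fg.
have pg0 x : (0 <= (g \_ D) x)%E by exact: le_trans (pfg x).
rewrite !ge0_integralTE//; apply: ereal_sup_le => _ [h /= hf <-].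
exists h => //= x; exact: le_trans (hf x) (pfg x).
Qed.

Section maximal.
Context {R : realType}.
Local Notation mu := (@lebesgue_measure R).
Implicit Types f g : R -> R.

Lemma continuous_locally_integrable f :
  continuous f -> locally_integrable [set: R] f.
Proof.
move=> cf; split => //; first exact: continuous_measurable_fun.
  exact: openT.
move=> K _ cK.
have /integrableP[] : mu.-integrable K (EFin \o f).
  by apply: continuous_compact_integrable => //; exact: continuous_subspaceT.
by [].
Qed.

Lemma measurable_norm_gt f (a : R) : measurable_fun setT f ->
  measurable [set y | a < `|f y|].
Proof.
move=> mf.
have mnf : measurable_fun setT (fun y => `|f y|) by exact: measurableT_comp.
have := mnf measurableT _ (measurable_itv `]a, +oo[).
rewrite setTI; congr measurable; apply/seteqP.
by split => y /=; rewrite in_itv/= andbT.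
Qed.

Lemma iavg_le_bound f (a x r : R) : 0 < r -> measurable_fun setT f ->
  (forall y, `|f y| <= a) -> (iavg f (ball x r) <= a%:E)%E.
Proof.
move=> r0 mf fa.
have mb : measurable (ball x r) by exact: measurable_ball.
rewrite /iavg lebesgue_measure_ball ?(ltW r0)//.
have r2 : 0 < r *+ 2 by rewrite mulrn_wgt0.
rewrite inver (gt_eqF r2).
rewrite lee_pdivrMl// muleC -(lebesgue_measure_ball x (ltW r0)) -integral_cst//.
by apply: ge0_le_integral_nonmeasurable => // y _ /=; rewrite lee_fin.
Qed.

(** Where [|f| <= a], the function contributes at most [a] to any average. *)
Lemma HL_maximal_truncation f (a x : R) : 0 <= a -> locally_integrable setT f ->
  (HL_maximal f x <=
   a%:E + HL_maximal (f \_ [set y | a < `|f y|]%R) x)%E.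
Proof.
move=> a0 [mf _ _]; apply: ge_ereal_sup => _ [r r0 <-].
have {}r0 : 0 < r by move: r0; rewrite /= in_itv/= andbT.
set S := [set y | _].
have mS : measurable S by exact: measurable_norm_gt.
have mfS : measurable_fun setT (f \_ S).
  by apply/(measurable_restrictT _ _).1 => //; exact: measurable_funTS.
have mfSC : measurable_fun setT (f \_ (~` S)).
  apply/(measurable_restrictT _ _).1; first exact: measurableC.
  exact: measurable_funTS.
have mb : measurable (ball x r) by exact: measurable_ball.
have fE : (f \_ (~` S)) \+ (f \_ S) = f.
  apply/funext => y /=; rewrite !patchE in_setC.
  by case: (y \in S); rewrite ?addr0 ?add0r.
rewrite -{1}fE.
apply: le_trans (iavgD _ _ _ _) _ => //.
- by rewrite lebesgue_measure_ball ?(ltW r0)// ltry.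
- exact: measurable_funTS.
- exact: measurable_funTS.
apply: leeD.
  apply: iavg_le_bound => // y; rewrite patchE in_setC.
  case: ifPn => [|_]; last by rewrite normr0.
  by move=> /negP; rewrite inE /S/= => /negP; rewrite -leNgt.
by apply: ereal_sup_ubound; exists r => //=; rewrite in_itv/= r0.
Qed.

(** Only the values of [f] above [c / 2] can push an average above [c]. Restricting
    the integral to them is what upgrades the weak-type bound to a bound in
    [L^p], since the integral over the levels [c], weighted by [c ^ (p - 1)],
    then converges. *)
Lemma maximal_inequality_truncated f c : continuous f -> 0 < c ->
  (mu [set x | c%:E < HL_maximal f x] <=
   (6 / c)%:E * \int[mu]_(x in [set y | c / 2 < `|f y|]%R) `|(f x)%:E|)%E.
Proof.
move=> cf c0; have c20 : 0 < c / 2 by rewrite divr_gt0.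
have lf := continuous_locally_integrable cf.
have mf := continuous_measurable_fun cf.
set S := [set y | c / 2 < `|f y|].
have mS : measurable S by exact: measurable_norm_gt.
have lfS : locally_integrable setT (f \_ S).
  by apply: (locally_integrableS mS measurableT (@subsetT _ S)); rewrite patch_setT.
have -> : (\int[mu]_(x in S) `|(f x)%:E| = \int[mu]_x `|((f \_ S) x)%:E|)%E.
  rewrite integral_mkcond; apply: eq_integral => x _.
  by rewrite !patchE; case: ifPn => //; rewrite abse0.
have -> : 6 / c = 3 / (c / 2) by field; rewrite gt_eqF.
apply: le_trans (maximal_inequality lfS c20).
apply: le_measure; rewrite ?inE.
- rewrite -[X in measurable X]setTI; apply: emeasurable_fun_o_infty => //.
  exact: measurable_HL_maximal.
- rewrite -[X in measurable X]setTI; apply: emeasurable_fun_o_infty => //.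
  exact: measurable_HL_maximal.
move=> x /= cx.
have := lt_le_trans cx (HL_maximal_truncation x (ltW c20) lf).
rewrite -/S {1}(splitr c) EFinD lteD2lE//.
Qed.

(** The increment is an integral of the derivative over a segment contained in
    the ball of radius [2 |t|], whose length is [4 |t|]. *)
Lemma slope_le_HL_maximal f g (s t : R) :
  continuous f -> (forall x, is_derive x (1 : R) g (f x)) ->
  ((`|g (s + t) - g s| / `|t|)%:E <= 4%:E * HL_maximal f s)%E.
Proof.
move=> cf dg; have mf := continuous_measurable_fun cf.
have lf := continuous_locally_integrable cf.
have [->|t0] := eqVneq t 0.
  by rewrite addr0 subrr normr0 mul0r mule_ge0// HL_maximalT_ge0.
have nt0 : 0 < `|t| by rewrite normr_gt0.
have cg : continuous g.
  by move=> x; apply: differentiable_continuous; apply/derivable1_diffP; case: (dg x).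
have ftc a b : a < b -> `[a, b] `<=` ball s (`|t| *+ 2) ->
    (`|g b - g a|%:E <= \int[mu]_(x in ball s (`|t| *+ 2)) `|(f x)%:E|)%E.
  move=> ab sab.
  have dgab : derivable_oo_LRcontinuous g a b.
    split; first by move=> x _; case: (dg x).
      by apply: cvg_at_right_filter; exact: cg.
    by apply: cvg_at_left_filter; exact: cg.
  have g'f : {in `]a, b[, derive1 g =1 f}.
    by move=> x _; rewrite derive1E; apply: derive_val.
  have := continuous_FTC2 ab (continuous_subspaceT cf) dgab g'f.
  rewrite -EFinB => E.
  have -> : (`|g b - g a|%:E = `|(g b - g a)%:E|)%E by [].
  rewrite -E; apply: le_trans (le_abse_integral _ _ _) _ => //.
    by apply/measurable_EFinP; exact: measurable_funTS.
  apply: ge0_subset_integral => //; first exact: measurable_ball.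
  by apply: measurableT_comp => //; apply/measurable_EFinP; exact: measurable_funTS.
have main : (`|g (s + t) - g s|%:E <=
    \int[mu]_(x in ball s (`|t| *+ 2)) `|(f x)%:E|)%E.
  have [tp|tn|] := ltgtP t 0; last by move/eqP; rewrite (negbTE t0).
    rewrite distrC; apply: ftc; first by rewrite gtrDl.
    move=> x /=; rewrite in_itv/= /ball/= => /andP[h1 h2].
    by rewrite ltr_norml ltr0_norm//; apply/andP; split; lra.
  apply: ftc; first by rewrite ltrDl.
  move=> x /=; rewrite in_itv/= /ball/= => /andP[h1 h2].
  by rewrite ltr_norml gtr0_norm//; apply/andP; split; lra.
have H : (iavg f (ball s (`|t| *+ 2)) <= HL_maximal f s)%E.
  apply: ereal_sup_ubound; exists (`|t| *+ 2) => //=.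
  by rewrite in_itv/= andbT mulrn_wgt0.
apply: le_trans (lee_wpmul2l _ H) => //.
rewrite /iavg lebesgue_measure_ball; last by rewrite mulrn_wge0.
rewrite inver gt_eqF; last by rewrite !mulrn_wgt0.
rewrite muleA -EFinM.
have -> : 4 * (`|t| *+ 2 *+ 2)^-1 = `|t|^-1 by field; rewrite gt_eqF.
by rewrite mulrC EFinM lee_pmul2l// lte_fin invr_gt0.
Qed.

End maximal.

(** * The maximal difference quotient on the line *)

Section slope.
Context {R : realType}.
Local Notation mu := (@lebesgue_measure R).
Implicit Types f g : R -> R.

(** One half of the layer-cake formula, in the variable [t] for which the levels
    are [t ^ (1 / (p - 1))]: the density is then proportional to the level itself
    and cancels the inverse of the level in the maximal inequality. The factor
    [2 ^ (1 / (p - 1) + 1)] is not sharp. *)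
Lemma powR_le_integral (p b : R) : 1 < p -> 0 <= b ->
  ((b `^ p)%:E <= (2 `^ ((p - 1)^-1 + 1))%:E *
    \int[mu]_t (t `^ (p - 1)^-1 *
                \1_[set t | 0 < t /\ t `^ (p - 1)^-1 < b]%R t)%:E)%E.
Proof.
move=> p1 b0; set r := (p - 1)^-1.
have p10 : 0 < p - 1 by rewrite subr_gt0.
have r0 : 0 < r by rewrite invr_gt0.
have I0 c : (0 <= \int[mu]_t (t `^ r *
    \1_[set t | 0 < t /\ t `^ r < c]%R t)%:E)%E.
  by apply: integral_ge0 => t _; rewrite lee_fin mulr_ge0// powR_ge0.
move: b0; rewrite le_eqVlt => /predU1P[<-|b0].
  rewrite powR0; last by rewrite gt_eqF// (lt_trans _ p1).
  by apply: mule_ge0; rewrite ?lee_fin ?powR_ge0.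
set B := b `^ (p - 1).
have B0 : 0 < B by exact: powR_gt0.
have Br : B `^ r = b by rewrite -powRrM mulfV ?gt_eqF// powRr1// ltW.
have B20 : 0 < B / 2 by rewrite divr_gt0.
(* the upper half of the interval of integration, of length [B / 2], already
   carries enough mass *)
have H : ((b `^ p)%:E = (2 `^ (r + 1))%:E *
    \int[mu]_(t in `](B / 2)%R, B[) ((B / 2) `^ r)%:E)%E.
  rewrite integral_cst//= lebesgue_measure_itv/= lte_fin.
  rewrite (_ : B / 2 < B); last by lra.
  rewrite -EFinB -!EFinM; congr EFin.
  have -> : B - B / 2 = (B / 2) `^ 1 by rewrite powRr1 ?ltW//; field.
  rewrite -powRD; last by rewrite (gt_eqF B20) implybT.
  rewrite -powRM ?ltW// mulrC divfK// /B -powRrM; congr (_ `^ _).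
  by rewrite /r mulrDr mulfV ?gt_eqF// mulr1; ring.
rewrite H; apply: lee_wpmul2l; first by rewrite lee_fin powR_ge0.
rewrite integral_mkcond; apply: ge0_le_integral_nonmeasurable => t _.
  by rewrite patchE; case: ifPn => // _; rewrite lee_fin powR_ge0.
rewrite patchE; case: ifPn => [|_]; last by rewrite lee_fin mulr_ge0// powR_ge0.
rewrite inE/= in_itv/= => /andP[t1 t2].
have t0 : 0 < t by exact: lt_trans t1.
have tr : t `^ r < b by rewrite -Br gt0_ltr_powR// nnegrE ltW.
rewrite indicE mem_set// mulr1 lee_fin; apply: ge0_ler_powR; rewrite ?nnegrE//; exact: ltW.
Qed.

Lemma integral_powR_lt (p a : R) : 1 < p -> 0 <= a ->
  (\int[mu]_t (\1_[set t | 0 < t /\ t `^ (p - 1)^-1 < a]%R t)%:E <=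
   (a `^ (p - 1))%:E)%E.
Proof.
move=> p1 a0; set r := (p - 1)^-1.
have p10 : 0 < p - 1 by rewrite subr_gt0.
have r0 : 0 < r by rewrite invr_gt0.
apply: (@le_trans _ _ (\int[mu]_t (\1_(`]0, a `^ (p - 1)[%classic) t)%:E)%E).
  apply: ge0_le_integral_nonmeasurable => t _; rewrite lee_fin//.
  rewrite !indicE ler_nat.
  case: (boolP (t \in [set _ | _])) => //; rewrite inE/= => -[t0 ta].
  rewrite mem_set//= in_itv/= t0/=.
  have -> : t = (t `^ r) `^ (p - 1).
    by rewrite -powRrM mulVf ?lt0r_neq0// powRr1// ltW.
  apply: gt0_ltr_powR; rewrite ?nnegrE//.
  exact: powR_ge0.
rewrite integral_indic// setIT/= lebesgue_measure_itv/= lte_fin.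
by case: ifP => _; rewrite ?sube0// lee_fin powR_ge0.
Qed.

(** The truncated maximal inequality at the level [t ^ r / 4]: its constant is
    inversely proportional to the level, so the factor [t ^ r] cancels. *)
Lemma integral_HL_maximal_level f (r t : R) : continuous f ->
  (\int[mu]_s (t `^ r *
      \1_[set s | 0 < t /\ ((t `^ r)%:E < 4%:E * HL_maximal f s)%E]%R s)%:E <=
   24%:E * \int[mu]_s (`|f s| *
      \1_[set s | 0 < t /\ t `^ r < 8 * `|f s|]%R s)%:E)%E.
Proof.
move=> cf; have lf := continuous_locally_integrable cf.
have mHL := measurable_HL_maximal lf.
have [t0|t0] := pselect (0 < t); last first.
  rewrite integral0_eq.
    by apply: mule_ge0 => //; apply: integral_ge0 => s _; rewrite lee_fin mulr_ge0.
  by move=> s _; rewrite indicE memNset ?mulr0// => -[/=].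
have tr0 : 0 < t `^ r by exact: powR_gt0.
have c0 : 0 < t `^ r / 4 by rewrite divr_gt0.
set L := [set s | (t `^ r / 4)%:E < HL_maximal f s]%E.
have mL : measurable L.
  by rewrite -[L]setTI; exact: emeasurable_fun_o_infty.
have -> : [set s | 0 < t /\ ((t `^ r)%:E < 4%:E * HL_maximal f s)%E] = L.
  by apply/seteqP; split => s; rewrite /L/= mulrC EFinM lte_pdivrMl// => -[].
under eq_integral do rewrite EFinM.
rewrite ge0_integralZl//; first last.
- by rewrite lee_fin ltW.
- exact/measurable_EFinP/measurable_indic.
rewrite integral_indic// setIT.
apply: le_trans (lee_wpmul2l _ (maximal_inequality_truncated cf c0)) _.
  by rewrite lee_fin ltW.
rewrite muleA -EFinM.
have -> : t `^ r * (6 / (t `^ r / 4)) = 24 by field; rewrite gt_eqF.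
apply: lee_wpmul2l => //; rewrite integral_mkcond.
apply: ge0_le_integral_nonmeasurable => s _; rewrite patchE; case: ifPn => // h.
  rewrite lee_fin ler_peMr// indicE mem_set//; split => //=.
  by move: h; rewrite inE/=; lra.
by rewrite lee_fin mulr_ge0.
Qed.

(** Rational increments make the supremum countable, hence measurable. The
    increment [0] contributes [0 ^ p], the quotient by [0] being [0]. *)
Definition slope_sup (p : R) g (s : R) : \bar R :=
  ereal_sup (range (fun q : rat =>
    ((`|g (s + ratr q) - g s| / `|ratr q : R|) `^ p)%:E)).

(** Difference quotients are below [4 HL_maximal f], so the layer-cake bound
    writes the left-hand side as an integral over levels and points. Tonelli's
    theorem lets the truncated maximal inequality act on each level; a second
    exchange leaves, at the point [s], the integral of [|f s|] over the levels
    below a multiple of [|f s|], which is a multiple of [|f s| ^ p]. *)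
Lemma slope_sup_inequality (p : R) : 1 < p -> exists2 C : R, 0 <= C &
  forall f g, continuous f -> (forall x, is_derive x (1 : R) g (f x)) ->
  (\int[mu]_s slope_sup p g s <= C%:E * \int[mu]_s (`|f s| `^ p)%:E)%E.
Proof.
move=> p1; set r := (p - 1)^-1.
have p10 : 0 < p - 1 by rewrite subr_gt0.
have r0 : 0 < r by rewrite invr_gt0.
exists (2 `^ (r + 1) * (24 * 8 `^ (p - 1))).
  by rewrite !mulr_ge0// powR_ge0.
move=> f g cf dg.
have mf := continuous_measurable_fun cf.
have lf := continuous_locally_integrable cf.
pose u s := (4%:E * HL_maximal f s)%E.
have mHL := measurable_HL_maximal lf.
have mu4 : measurable_fun setT u by exact: measurable_funeM.
pose A := [set z : R * R | 0 < z.2 /\ ((z.2 `^ r)%:E < u z.1)%E].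
pose B := [set z : R * R | 0 < z.2 /\ z.2 `^ r < 8 * `|f z.1|].
have mpow : measurable_fun setT (fun z : R * R => z.2 `^ r).
  by apply: measurableT_comp (measurable_powR r) _.
have m2 : measurable [set z : R * R | 0 < z.2].
  have := @measurable_snd _ _ R R measurableT _ (measurable_itv `]0, +oo[).
  rewrite setTI; congr measurable; apply/seteqP.
  by split => z /=; rewrite in_itv/= andbT.
have mA : measurable A.
  suff : measurable [set z : R * R | ((z.2 `^ r)%:E < u z.1)%E] by exact: measurableI.
  have -> : [set z : R * R | ((z.2 `^ r)%:E < u z.1)%E] =
    setT `&` [set z | (0 < u z.1 - (z.2 `^ r)%:E)%E].
    by rewrite setTI; apply/seteqP; split => z; rewrite /mkset sube_gt0.
  apply: emeasurable_fun_o_infty => //.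
  apply: emeasurable_funB; first exact: measurableT_comp.
  exact/measurable_EFinP.
have mnf : measurable_fun setT (fun z : R * R => `|f z.1|).
  by apply: measurableT_comp => //; exact: measurableT_comp.
have mB : measurable B.
  suff : measurable [set z : R * R | z.2 `^ r < 8 * `|f z.1|] by exact: measurableI.
  have -> : [set z : R * R | z.2 `^ r < 8 * `|f z.1|] =
    setT `&` [set z | (0 < (8 * `|f z.1| - z.2 `^ r)%:E)%E].
    by rewrite setTI; apply/seteqP; split => z /=; rewrite lte_fin subr_gt0.
  apply: emeasurable_fun_o_infty => //; apply/measurable_EFinP.
  by apply: measurable_funB => //; exact: measurable_funM.
pose phi (z : R * R) := (z.2 `^ r * \1_A z)%:E.
pose psi (z : R * R) := (`|f z.1| * \1_B z)%:E.
have phi0 z : (0 <= phi z)%E by rewrite lee_fin mulr_ge0// powR_ge0.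
have psi0 z : (0 <= psi z)%E by rewrite lee_fin mulr_ge0.
have mphi : measurable_fun setT phi.
  by apply/measurable_EFinP; exact: measurable_funM.
have mpsi : measurable_fun setT psi.
  by apply/measurable_EFinP; exact: measurable_funM.
have step1 s : (slope_sup p g s <=
    (2 `^ (r + 1))%:E * \int[mu]_t phi (s, t))%E.
  apply: ge_ereal_sup => _ [q _ <-].
  set b := _ / _.
  have bu : (b%:E <= u s)%E by exact: slope_le_HL_maximal.
  apply: le_trans (powR_le_integral p1 (_ : 0 <= b)) _; first exact: divr_ge0.
  rewrite lee_wpmul2l ?lee_fin ?powR_ge0//.
  apply: ge0_le_integral_nonmeasurable => t _; rewrite lee_fin.
    by rewrite mulr_ge0// powR_ge0.
  rewrite ler_wpM2l ?powR_ge0// !indicE ler_nat.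
  case: (boolP (t \in _)) => //; rewrite inE/= => -[t0 tb].
  by rewrite mem_set//; split => //=; apply: lt_le_trans bu; rewrite lte_fin.
have step3 t : (\int[mu]_s phi (s, t) <= 24%:E * \int[mu]_s psi (s, t))%E.
  exact: integral_HL_maximal_level.
have step4 s : (\int[mu]_t psi (s, t) <= (8 `^ (p - 1))%:E * (`|f s| `^ p)%:E)%E.
  rewrite (_ : (fun t => psi (s, t)) = fun t => (`|f s|%:E *
    (\1_[set t | 0 < t /\ t `^ r < 8 * `|f s|]%R t)%:E)%E); last first.
    by apply/funext => t; rewrite -EFinM.
  rewrite ge0_integralZl//; last first.
    apply/measurable_EFinP/measurable_indic.
    suff <- : xsection B s = [set t | 0 < t /\ t `^ r < 8 * `|f s|].
      exact: measurable_xsection.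
    by rewrite xsectionE.
  apply: le_trans (lee_wpmul2l _ (integral_powR_lt p1 (_ : 0 <= 8 * `|f s|))) _ => //.
  rewrite -!EFinM lee_fin powRM// mulrCA mulr_powRB1//.
  exact: lt_trans p1.
have mpsiF := measurable_fun_fubini_tonelli_F psi mpsi psi0.
have mphiG := measurable_fun_fubini_tonelli_G phi mphi phi0.
rewrite EFinM -muleA.
apply: (@le_trans _ _ (\int[mu]_s ((2 `^ (r + 1))%:E * \int[mu]_t phi (s, t)))%E).
  apply: ge0_le_integral_nonmeasurable => s _ //.
  by apply: le_ereal_sup_tmp; exists 0%E => //; exists 0 => //; 
     rewrite rmorph0 normr0 invr0 mulr0 powR0// gt_eqF// (lt_trans _ p1).
rewrite ge0_integralZl//=; first last.
- by move=> s _; exact: integral_ge0.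
- exact: measurable_fun_fubini_tonelli_F.
rewrite lee_wpmul2l ?lee_fin ?powR_ge0// fubini_tonelli//.
apply: (@le_trans _ _ (\int[mu]_t (24%:E * \int[mu]_s psi (s, t)))%E).
  apply: ge0_le_integral_nonmeasurable => t _ //; exact: integral_ge0.
rewrite ge0_integralZl//=; first last.
- by move=> s _; exact: integral_ge0.
- exact: measurable_fun_fubini_tonelli_G.
rewrite EFinM -muleA lee_wpmul2l// -fubini_tonelli//.
rewrite -ge0_integralZl//; first last.
- apply/measurable_EFinP; apply: measurableT_comp (measurable_powR p) _.
  exact: measurableT_comp.
by apply: ge0_le_integral_nonmeasurable => s _ //; exact: integral_ge0.
Qed.

End slope.

(** * Integration along coordinate lines *)

Section lines.
Context {R : realType}.
Local Notation mu := (@lebesgue_measure R).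

Definition set_coord n (i : 'I_n) (x : 'rV[R]_n) (s : R) : 'rV[R]_n :=
  \row_j (if j == i then s else x ord0 j).

Lemma set_coord_same n (i : 'I_n) (x : 'rV[R]_n) s :
  set_coord i x s ord0 i = s.
Proof. by rewrite mxE eqxx. Qed.

Lemma set_coord_id n (i : 'I_n) (x : 'rV[R]_n) :
  set_coord i x (x ord0 i) = x.
Proof. by apply/rowP => j; rewrite mxE; case: eqP => [->|]. Qed.

Lemma set_coord_set_coord n (i : 'I_n) (x : 'rV[R]_n) s t :
  set_coord i (set_coord i x s) t = set_coord i x t.
Proof. by apply/rowP => j; rewrite !mxE; case: eqP. Qed.

Lemma set_coord_rV_cons0 n (z : measurableTypeR R * 'rV[R]_n) s :
  set_coord ord0 (rV_cons z) s = rV_cons (s, z.2).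
Proof.
apply/rowP => j; rewrite mxE; case: (unliftP ord0 j) => [k ->|->].
  by rewrite eq_sym (negbTE (neq_lift _ _)) !rV_consS.
by rewrite eqxx rV_cons0.
Qed.

Lemma set_coord_rV_consS n (z : measurableTypeR R * 'rV[R]_n) i s :
  set_coord (lift ord0 i) (rV_cons z) s = rV_cons (z.1, set_coord i z.2 s).
Proof.
apply/rowP => j; rewrite mxE; case: (unliftP ord0 j) => [k ->|->].
  by rewrite !rV_consS mxE (inj_eq lift_inj).
by rewrite (negbTE (neq_lift _ _)) !rV_cons0.
Qed.

Lemma ge0_integral_lebesgue_rVS n (F : 'rV[R]_n.+1 -> \bar R) :
  measurable_fun setT F -> (forall x, 0 <= F x)%E ->
  (\int[lebesgue_rV n.+1]_x F x =
   \int[mu \x lebesgue_rV n]_z F (rV_cons z))%E.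
Proof.
move=> mF F0.
have mc : measurable_fun setT (@rV_cons R n) := @measurable_rV_cons R n.
transitivity (\int[pushforward (mu \x lebesgue_rV n) (@rV_cons R n)]_x F x)%E.
  exact: eq_measure_integral.
by rewrite (ge0_integral_pushforward mc).
Qed.

(** Lebesgue measure peels off the first coordinate. Tonelli's theorem integrates
    that coordinate first when it is the chosen one; otherwise it integrates it
    last, and the induction hypothesis applies to the remaining ones. *)
Lemma le_integral_lines n (i : 'I_n) (F G : 'rV[R]_n -> \bar R) :
  measurable_fun setT F -> (forall x, 0 <= F x)%E ->
  measurable_fun setT G -> (forall x, 0 <= G x)%E ->
  (forall x, \int[mu]_s F (set_coord i x s) <=
             \int[mu]_s G (set_coord i x s))%E ->
  (\int[lebesgue_rV n]_x F x <= \int[lebesgue_rV n]_x G x)%E.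
Proof.
elim: n => [|n IHn] in i F G *; first by case: i.
move=> mF F0 mG G0 FG.
have mc : measurable_fun setT (@rV_cons R n) := @measurable_rV_cons R n.
have mFc : measurable_fun setT (F \o @rV_cons R n) by exact: measurableT_comp.
have mGc : measurable_fun setT (G \o @rV_cons R n) by exact: measurableT_comp.
have Fc0 z : (0 <= (F \o @rV_cons R n) z)%E by exact: F0.
have Gc0 z : (0 <= (G \o @rV_cons R n) z)%E by exact: G0.
rewrite !ge0_integral_lebesgue_rVS//.
case: (unliftP ord0 i) FG => [j ->|->] FG.
- rewrite (fubini_tonelli1 (F \o @rV_cons R n))//.
  rewrite (fubini_tonelli1 (G \o @rV_cons R n))//.
  apply: ge0_le_integral_nonmeasurable => t _; first exact: integral_ge0.
  apply: (IHn j) => //.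
  + exact: (measurableT_comp mFc (pair1_measurable t)).
  + exact: (measurableT_comp mGc (pair1_measurable t)).
  + move=> v; have lineE (H : 'rV[R]_n.+1 -> \bar R) :
        (fun s => H (set_coord (lift ord0 j) (rV_cons (t, v)) s)) =
        (fun s => (H \o @rV_cons R n) (t, set_coord j v s)).
      by apply/funext => s; rewrite set_coord_rV_consS.
    by have := FG (rV_cons (t, v)); rewrite !lineE.
- rewrite (fubini_tonelli2 (F \o @rV_cons R n))//.
  rewrite (fubini_tonelli2 (G \o @rV_cons R n))//.
  apply: ge0_le_integral_nonmeasurable => v _; first exact: integral_ge0.
  have lineE (H : 'rV[R]_n.+1 -> \bar R) :
      (fun s => H (set_coord ord0 (rV_cons (0, v)) s)) =
      (fun s => (H \o @rV_cons R n) (s, v)).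
    by apply/funext => s; rewrite set_coord_rV_cons0.
  by have := FG (rV_cons (0, v)); rewrite !lineE.
Qed.

End lines.

Section measurability.
Context {R : realType} (n : nat).

(** An open set is the countable union of the boxes with rational centre and
    radius [1 / (k + 1)] that it contains. *)
Lemma open_measurable_rV (U : set 'rV[R]_n) : open U -> measurable U.
Proof.
move=> oU.
pose box (c : 'rV[rat]_n * nat) : set 'rV[R]_n :=
  [set x | forall i, ball (ratr (c.1 ord0 i) : R) c.2.+1%:R^-1 (x ord0 i)].
have mbox c : measurable (box c).
  by apply: (@measurable_rV_box _ _ (fun i =>
    ball (ratr (c.1 ord0 i) : R) c.2.+1%:R^-1)) => i; exact: measurable_ball.
have -> : U = \bigcup_(c in setT)
    (if pselect (box c `<=` U) then box c else set0).
  apply/seteqP; split => [x Ux|x [c _]]; last by case: pselect => // cU /cU.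
  have /nbhs_ballP[e /= e0 eU] : nbhs x U by exact: open_nbhs_nbhs.
  (* with radii below [e / 2], a box around a centre near [x] stays in the ball
     of radius [e] *)
  have [k ke] : exists k, (k.+1%:R)^-1 < e / 2 :> R.
    have := @near_infty_natSinv_lt R (PosNum (divr_gt0 e0 (ltr0Sn R 1))).
    by case=> k _ /(_ k (leqnn k)); exists k.
  have [d dE] : exists d : R, d = k.+1%:R^-1 by exists k.+1%:R^-1.
  have d0 : 0 < d by rewrite dE invr_gt0.
  rewrite -dE in ke.
  have xq i : exists q : rat, ball (x ord0 i) d (ratr q : R).
    have xd : x ord0 i - d < x ord0 i + d by lra.
    have [q] := rat_in_itvoo xd.
    rewrite in_itv/= => /andP[q1 q2]; exists q.
    by rewrite /ball/= ltr_norml; apply/andP; split; lra.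
  have /choice[q qx] := xq.
  have bx : box (\row_i q i, k) x.
    by move=> i /=; rewrite mxE -dE; apply: ball_sym; exact: qx.
  exists (\row_i q i, k) => //; case: pselect => // -[]; move=> y /= yb.
  apply: eU; split => // i0 j; rewrite !ord1.
  have := yb j; have := bx j; rewrite /= !mxE -!dE /ball/= !ltr_norml.
  by move=> /andP[a1 a2] /andP[b1 b2]; apply/andP; split; lra.
apply: countable_bigcupT_measurable => [|c]; last first.
  by case: pselect => ? /=; [exact: mbox|exact: measurable0].
exact: (@countableP ('rV[rat]_n * nat)%type).
Qed.

Lemma continuous_measurable_fun_rV (f : 'rV[R]_n -> R) :
  continuous f -> measurable_fun setT f.
Proof.
move=> /continuousP cf mT; apply: (measurability _ (RGenOpens.measurableE R)) => //.
by move=> _ [_ [a [b ->] <-]]; rewrite setTI; apply: open_measurable_rV;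
  apply: cf; exact: interval_open.
Qed.

End measurability.

Lemma measurable_ereal_sup_rat d (T : measurableType d) (R : realType)
    (h : rat -> T -> \bar R) : (forall q, measurable_fun setT (h q)) ->
  measurable_fun setT (fun x => ereal_sup (range (h^~ x))).
Proof.
move=> mh mT; apply: (measurability _ (ErealGenOInfty.measurableE R)) => //.
move=> _ [_ [a ->] <-]; rewrite setTI.
have -> : (fun x => ereal_sup (range (h^~ x))) @^-1` `]a%:E, +oo[ =
    \bigcup_q [set x | a%:E < h q x]%E.
  apply/seteqP; split => [x|x [q _ /= aq]] /=; rewrite in_itv/= andbT.
    by move=> /ereal_sup_gt[_ [q _ <-] aq]; exists q.
  by apply: lt_le_trans aq _; apply: ereal_sup_ubound; exists q.
apply: bigcupT_measurable_rat => q.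
by rewrite -[X in measurable X]setTI; exact: emeasurable_fun_o_infty.
Qed.

(** * Exit along a coordinate axis *)

Section geometry.
Context {R : realType} (n : nat).
Implicit Types (x y z : 'rV[R]_n) (A : set 'rV[R]_n).

Lemma enorm_ge0 x : 0 <= enorm x.
Proof. exact: sqrtr_ge0. Qed.

Lemma enorm_sqr x : enorm x ^+ 2 = \sum_i x ord0 i ^+ 2.
Proof. by rewrite sqr_sqrtr// sumr_ge0// => i _; exact: sqr_ge0. Qed.

Lemma normr_coord_le_enorm x i : `|x ord0 i| <= enorm x.
Proof.
rewrite -sqrtr_sqr ler_wsqrtr// (bigD1 i)//= lerDl sumr_ge0// => j _.
exact: sqr_ge0.
Qed.

(** The triangle inequality, obtained coordinatewise from
    [(u - v)^2 <= (1 + b / a) u^2 + (1 + a / b) v^2]. *)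
Lemma enormB_le x y (a b : R) : 0 < a -> 0 < b -> enorm x <= a -> enorm y <= b ->
  enorm (x - y) <= a + b.
Proof.
move=> a0 b0 xa yb.
have xa2 : enorm x ^+ 2 <= a ^+ 2 by rewrite ler_sqr// nnegrE ?enorm_ge0 ?ltW.
have yb2 : enorm y ^+ 2 <= b ^+ 2 by rewrite ler_sqr// nnegrE ?enorm_ge0 ?ltW.
have a0' := ltW a0; have b0' := ltW b0.
rewrite -ler_sqr ?nnegrE ?enorm_ge0 ?addr_ge0//.
apply: (@le_trans _ _ ((1 + b / a) * enorm x ^+ 2 + (1 + a / b) * enorm y ^+ 2)).
  rewrite !enorm_sqr !mulr_sumr -big_split/=; apply: ler_sum => i _.
  rewrite !mxE; set u := x _ _; set v := y _ _.
  rewrite -subr_ge0.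
  have -> : (1 + b / a) * u ^+ 2 + (1 + a / b) * v ^+ 2 - (u - v) ^+ 2 =
      (b * u + a * v) ^+ 2 / (a * b).
    by field; rewrite !gt_eqF.
  by rewrite divr_ge0 ?sqr_ge0// mulr_ge0 ?ltW.
apply: (@le_trans _ _ ((1 + b / a) * a ^+ 2 + (1 + a / b) * b ^+ 2)).
  by apply: lerD; apply: ler_wpM2l => //; rewrite addr_ge0// divr_ge0.
by rewrite le_eqVlt; apply/orP; left; apply/eqP; field; rewrite !gt_eqF.
Qed.

Lemma enorm_le_coord x : (0 < n)%N ->
  exists i, enorm x <= n%:R * `|x ord0 i|.
Proof.
move=> n0; pose i0 := Ordinal n0.
case: (@arg_maxP _ _ _ i0 predT (fun i => x ord0 i ^+ 2) isT) => i _ imax.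
exists i; have n1 : 1 <= n%:R :> R by rewrite ler1n.
rewrite -ler_sqr ?nnegrE ?enorm_ge0 ?mulr_ge0// enorm_sqr exprMn real_normK ?num_real//.
apply: (@le_trans _ _ (n%:R * x ord0 i ^+ 2)).
  rewrite mulr_natl -[X in _ *+ X](card_ord n) -sumr_const.
  by apply: ler_sum => j _; exact: imax.
by rewrite ler_wpM2r ?sqr_ge0// expr2 ler_peMr// (le_trans ler01).
Qed.

Lemma dist_lbound x A : has_lbound [set enorm (x - y) | y in A].
Proof. by exists 0 => _ [y _ <-]; exact: enorm_ge0. Qed.

Lemma dist_le_enorm x y A : A y -> dist x A <= enorm (x - y).
Proof. by move=> Ay; apply: ge_inf; [exact: dist_lbound|exists y]. Qed.

Lemma dist_ge0 x A : 0 <= dist x A.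
Proof.
have [->|/set0P[y Ay]] := eqVneq A set0; first by rewrite /dist image_set0 inf0.
by apply: lb_le_inf => [|_ [z _ <-]]; [exists (enorm (x - y)), y|exact: enorm_ge0].
Qed.

Lemma dist_approx x A : 0 < dist x A ->
  exists2 y, A y & enorm (x - y) < 2 * dist x A.
Proof.
move=> d0; have A0 : A !=set0.
  apply/set0P; apply: contraTneq d0 => ->.
  by rewrite /dist image_set0 inf0 ltxx.
have hi : has_inf [set enorm (x - y) | y in A].
  by split; [case: A0 => y Ay; exists (enorm (x - y)), y|exact: dist_lbound].
have [_ [y Ay <-]] := inf_adherent d0 hi.
rewrite -/(dist x A) => dy; exists y => //; lra.
Qed.

Lemma coord_le_norm x i : `|x ord0 i| <= `|x|.
Proof.
rewrite [leRHS]mx_normrE.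
exact: (le_bigmax _ (fun ij : 'I_1 * 'I_n => `|x ij.1 ij.2|) (ord0, i)).
Qed.

(** The centre [y] of a ball of radius [r] that misses [x] and touches a point at
    distance [d] of [x] is at a distance [D] between [r] and [r + d] of [x]. A
    step [t] along the axis on which [y] is farthest has a component at least
    [D / n] in its favour, so the new squared distance is at most
    [D^2 - 2 |t| D / n + t^2]. With [|t| = 2 n d] the linear gain [4 d D] exceeds
    [D^2 - r^2], which is at most about [2 r d], by enough to absorb the
    quadratic term once [d] is small. *)
Lemma coordinate_step_into_ball x y (r d : R) : (0 < n)%N -> 0 < d ->
  2 * n%:R ^+ 2 * d < r -> r <= enorm (y - x) -> enorm (y - x) <= r + d ->
  exists i t, `|t| = 2 * n%:R * d /\
    enorm (y - set_coord i x (x ord0 i + t)) < r.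
Proof.
move=> n0 d0 dr rD Dr; have [i Di] := enorm_le_coord (y - x) n0.
set D := enorm (y - x) in rD Dr Di *.
have n1 : 1 <= n%:R :> R by rewrite ler1n.
have np : 0 < n%:R :> R by exact: lt_le_trans n1.
have r0 : 0 < r by apply: lt_trans dr; rewrite mulr_gt0// mulr_gt0// exprn_gt0.
set v := (y - x) ord0 i in Di.
pose t := Num.sg v * (2 * n%:R * d).
have v0 : v != 0.
  apply: contraTneq Di => ->; rewrite normr0 mulr0 -ltNge.
  exact: lt_le_trans rD.
have nt : `|t| = 2 * n%:R * d.
  rewrite normrM normr_sg v0 mul1r ger0_norm// !mulr_ge0// ltW//.
exists i, t; split => //.
rewrite -ltr_sqr ?nnegrE ?enorm_ge0 ?(ltW r0)//.
have -> : enorm (y - set_coord i x (x ord0 i + t)) ^+ 2 =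
    D ^+ 2 - 2 * t * v + t ^+ 2.
  rewrite !enorm_sqr (bigD1 i)//= [in RHS](bigD1 i)//= !mxE eqxx.
  rewrite (eq_bigr (fun j => (y - x) ord0 j ^+ 2)); last first.
    by move=> j ji; rewrite !mxE (negbTE ji).
  rewrite /v !mxE; ring.
have -> : 2 * t * v = 2 * (2 * n%:R * d * `|v|) by rewrite /t [`|v|]normrEsg; ring.
have -> : t ^+ 2 = (2 * n%:R * d) ^+ 2 by rewrite -nt real_normK ?num_real.
have H1 : 4 * d * D <= 2 * (2 * n%:R * d * `|v|).
  rewrite (_ : 2 * _ = 4 * d * (n%:R * `|v|)); last by ring.
  by rewrite ler_pM2l// mulr_gt0.
(* by convexity, [D ^+ 2] lies below its chord over the segment [r, r + d] *)
have H2 : D ^+ 2 <= (2 * r + d) * D - r * (r + d).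
  rewrite -subr_ge0 (_ : _ - _ = (D - r) * (r + d - D)); last by ring.
  by rewrite mulr_ge0// subr_ge0.
have nn : 1 <= n%:R ^+ 2 :> R by rewrite exprn_ege1.
have H4 : 2 * d < r.
  by apply: le_lt_trans dr; apply: ler_wpM2r; rewrite ?(ltW d0)// ler_peMr.
have H3 : (2 * r - 3 * d) * D <= (2 * r - 3 * d) * (r + d).
  by apply: ler_wpM2l => //; lra.
have H5 : (2 * n%:R * d) ^+ 2 < 2 * d * r.
  rewrite (_ : _ ^+ 2 = 2 * d * (2 * n%:R ^+ 2 * d)); last by ring.
  by rewrite ltr_pM2l// mulr_gt0.
have := mulr_gt0 r0 d0; have := mulr_gt0 d0 d0.
move: H1 H2 H3 H5; move: (2 * (_ * `|v|)) ((2 * n%:R * d) ^+ 2) => a b.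
by nra.
Qed.

(** Close to the boundary, the exterior ball at an almost nearest boundary point
    is reached by a step along an axis. Away from it, the distance to the
    boundary is bounded below and a step longer than the width of the domain is
    comparable to it. *)
Lemma exterior_sphere_exit (r : R) A : (0 < n)%N -> 0 < r -> open A ->
  bounded_set A -> exterior_sphere r A ->
  exists2 K, 0 < K & forall x, A x -> 0 < dist x (boundary A) ->
    exists i t, `|t| <= K * dist x (boundary A) /\
      ~ A (set_coord i x (x ord0 i + t)).
Proof.
move=> n0 r0 oA [M0 [_ bA]] sA.
pose M := Num.max M0 0 + 1.
have M1 : M0 < M by rewrite /M ltr_pwDr// le_max lexx.
have Mp : 0 < M by rewrite /M ltr_pwDr// le_max lexx orbT.
have AM x i : A x -> `|x ord0 i| <= M.
  by move=> Ax; apply: le_trans (coord_le_norm x i) _; exact: bA Ax.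
have n1 : 1 <= n%:R :> R by rewrite ler1n.
have np : 0 < n%:R :> R by exact: lt_le_trans n1.
have c0 : 0 < 4 * n%:R ^+ 2 :> R by rewrite mulr_gt0// exprn_gt0.
pose N := 2 * M + 1.
have Np : 0 < N by apply: addr_gt0 => //; exact: mulr_gt0.
exists (4 * n%:R + N * (4 * n%:R ^+ 2 / r)).
  by apply: addr_gt0; apply: mulr_gt0 => //; exact: divr_gt0.
move=> x Ax; set d := dist x _ => d0.
have [dr|rd] := ltP (4 * n%:R ^+ 2 * d) r; last first.
  pose i := Ordinal n0; exists i, N; split.
    rewrite gtr0_norm// [leRHS]mulrDl -[leLHS]add0r.
    apply: lerD; first by rewrite !mulr_ge0// ltW.
    rewrite -[leRHS]mulrA ler_peMr ?(ltW Np)//.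
    by rewrite mulrAC ler_pdivlMr// mul1r.
  move=> /(AM _ i); rewrite set_coord_same ler_norml => /andP[_ h].
  by have := AM _ i Ax; rewrite ler_norml => /andP[h1 _]; move: h; rewrite /N; lra.
have [xi bxi xxi] := dist_approx d0.
have [y [yxi ry]] := sA _ bxi.
have rA z : A z -> r <= enorm (y - z).
  by move=> Az; apply: le_trans ry _; apply: dist_le_enorm; exact: subset_closure.
have dd : 0 < enorm (x - xi) by apply: lt_le_trans d0 _; exact: dist_le_enorm.
have [| | |i [t [tE tr]]] := @coordinate_step_into_ball x y r (enorm (x - xi)) n0 dd.
- apply: lt_trans dr; rewrite (_ : 4 * _ * d = 2 * n%:R ^+ 2 * (2 * d)); last by ring.
  by rewrite ltr_pM2l// mulr_gt0// exprn_gt0.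
- exact: rA.
- rewrite (_ : y - x = (y - xi) - (x - xi)); last by rewrite opprB addrA subrK.
  by apply: enormB_le => //; rewrite yxi.
exists i, t; split; last by move=> /rA; rewrite leNgt tr.
rewrite tE [leRHS]mulrDl -[leLHS]addr0; apply: lerD.
  rewrite (_ : 4 * _ * d = 2 * n%:R * (2 * d)); last by ring.
  by rewrite ler_pM2l ?mulr_gt0 ?(ltW xxi).
by rewrite ltW// mulr_gt0// mulr_gt0// divr_gt0.
Qed.

End geometry.

(** * Difference quotients along the axes *)

Section sections_along_axes.
Context {R : realType} (n : nat).
Implicit Types (x : 'rV[R]_n) (A : set 'rV[R]_n) (zeta : 'rV[R]_n -> R).

Lemma set_coordE (i : 'I_n) x (s t : R) :
  set_coord i x (s + t) = t *: delta_mx ord0 i + set_coord i x s.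
Proof.
apply/rowP => j; rewrite !mxE eqxx/=.
by case: eqP => _; rewrite ?mulr1 ?mulr0 ?add0r// addrC.
Qed.

Lemma continuous_set_coord (i : 'I_n) x : continuous (set_coord i x).
Proof.
have -> : set_coord i x = fun s => s *: delta_mx ord0 i + set_coord i x 0.
  by apply/funext => s; rewrite -set_coordE add0r.
by move=> s; apply: cvgD; [exact: scalel_continuous|exact: cvg_cst].
Qed.

Lemma is_derive_set_coord zeta (i : 'I_n) x (s : R) :
  derivable zeta (set_coord i x s) (delta_mx ord0 i) ->
  is_derive s (1 : R) (fun u => zeta (set_coord i x u))
    (partial i zeta (set_coord i x s)).
Proof.
move=> dz.
have E : (fun h : R => h^-1 *: (zeta (set_coord i x (h *: (1 : R) + s)) -
      zeta (set_coord i x s))) =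
    (fun h : R => h^-1 *: (zeta (h *: delta_mx ord0 i + set_coord i x s) -
      zeta (set_coord i x s))).
  by apply/funext => h; rewrite [_ *: 1]mulr1 [h + s]addrC set_coordE.
split; first by rewrite /derivable/= E.
by rewrite /partial /derive/= E.
Qed.

Lemma slope_sup_ge0 (p : R) (g : R -> R) (s : R) : (0 <= slope_sup p g s)%E.
Proof.
apply: le_ereal_sup_tmp.
exists ((`|g (s + ratr 0) - g s| / `|ratr 0 : R|) `^ p)%:E; first by exists 0.
by rewrite lee_fin powR_ge0.
Qed.

(** The quotient is continuous in the increment away from [0], so a real
    increment is approximated by rational ones. *)
Lemma slope_le_slope_sup (p : R) (g : R -> R) (s t : R) : 0 < p ->
  continuous g -> t != 0 ->
  (((`|g (s + t) - g s| / `|t|) `^ p)%:E <= slope_sup p g s)%E.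
Proof.
move=> p0 cg t0; rewrite leNgt; apply/negP => lt_sup.
have S0 := slope_sup_ge0 p g s.
have Sfin : slope_sup p g s \is a fin_num.
  by rewrite ge0_fin_numE// (lt_trans lt_sup)// ltry.
move: lt_sup S0; rewrite -(fineK Sfin) lte_fin lee_fin.
set S := fine _ => lt_sup S0.
pose b u := `|g (s + u) - g s| / `|u|.
have ltb : S `^ p^-1 < b t.
  rewrite ltNge; apply/negP => h.
  have := ge0_ler_powR (ltW p0) _ _ h; rewrite !nnegrE powR_ge0 divr_ge0//.
  move=> /(_ isT isT); rewrite -powRrM mulVf ?gt_eqF// powRr1// => h'.
  by move: lt_sup; rewrite ltNge h'.
have cb : {for t, continuous b}.
  apply: cvgM.
    apply: cvg_norm; apply: cvgB; last exact: cvg_cst.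
    apply: (@continuous_comp _ _ _ (fun u => s + u) g); last exact: cg.
    by apply: cvgD; [exact: cvg_cst|exact: cvg_id].
  by apply: cvgV; [rewrite normr_eq0|apply: cvg_norm; exact: cvg_id].
have : nbhs t [set u | S `^ p^-1 < b u] by exact: (cvgr_gt (b t) cb).
rewrite nbhsE => -[U [oU Ut] Ub].
have [u [Uq [q _ qE]]] := dense_rat (ex_intro _ t Ut) oU.
rewrite -qE in Uq; have /= hq := Ub _ Uq.
have : (((b (ratr q)) `^ p)%:E <= slope_sup p g s)%E.
  by apply: ereal_sup_ubound; exists q.
rewrite -(fineK Sfin) lee_fin -/S leNgt => /negP; apply.
have := gt0_ltr_powR p0 _ _ hq; rewrite !nnegrE powR_ge0 divr_ge0//.
by move=> /(_ isT isT); rewrite -powRrM mulVf ?gt_eqF// powRr1.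
Qed.

Definition axis_slope_sup (p : R) (i : 'I_n) zeta x : \bar R :=
  slope_sup p (fun s => zeta (set_coord i x s)) (x ord0 i).

Lemma measurable_axis_slope_sup (p : R) (i : 'I_n) zeta :
  continuous zeta -> measurable_fun setT (axis_slope_sup p i zeta).
Proof.
move=> cz; apply: (@measurable_ereal_sup_rat _ _ _ (fun q x =>
  ((`|zeta (set_coord i x (x ord0 i + ratr q)) -
      zeta (set_coord i x (x ord0 i))| / `|ratr q : R|) `^ p)%:E)) => q.
apply/measurable_EFinP; apply: measurableT_comp (measurable_powR p) _.
apply: measurable_funM => //; apply: measurableT_comp => //.
have cshift : continuous (fun y => zeta (set_coord i y (y ord0 i + ratr q))).
  have -> : (fun y => zeta (set_coord i y (y ord0 i + ratr q))) =
      zeta \o (fun y => (ratr q : R) *: delta_mx ord0 i + y).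
    by apply/funext => y /=; rewrite set_coordE set_coord_id.
  move=> x; apply: continuous_comp; last exact: cz.
  exact: (cvgD (cvg_cst _) cvg_id).
apply: continuous_measurable_fun_rV.
have -> : (fun y => zeta (set_coord i y (y ord0 i + ratr q)) -
    zeta (set_coord i y (y ord0 i))) =
    (fun y => zeta (set_coord i y (y ord0 i + ratr q))) - zeta.
  by apply/funext => y; rewrite set_coord_id.
by move=> x; exact: (cvgB (cshift x) (cz x)).
Qed.

(** The restriction of [axis_slope_sup] to a line in the direction [i] is the
    maximal difference quotient of the restriction of [zeta], whose derivative is
    the restriction of the partial derivative. *)
Lemma axis_slope_sup_inequality (p : R) : 1 < p -> exists2 C : R, 0 <= C &
  forall (i : 'I_n) zeta, smooth zeta ->
  (\int[lebesgue_rV n]_x axis_slope_sup p i zeta x <=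
   C%:E * \int[lebesgue_rV n]_x (`|partial i zeta x| `^ p)%:E)%E.
Proof.
move=> p1; have [C C0 HC] := @slope_sup_inequality R p p1.
exists C => // i zeta sz.
have [cz dz] := sz [::]; have [cdz _] := sz [:: i]; rewrite /= in cz dz cdz.
have mdz : measurable_fun setT (fun x => (`|partial i zeta x| `^ p)%:E).
  apply/measurable_EFinP; apply: measurableT_comp (measurable_powR p) _.
  by apply: measurableT_comp => //; exact: continuous_measurable_fun_rV.
rewrite -ge0_integralZl//.
apply: (@le_integral_lines _ _ i).
- exact: measurable_axis_slope_sup.
- by move=> x; exact: slope_sup_ge0.
- exact: measurable_funeM.
- by move=> x; rewrite mule_ge0// lee_fin powR_ge0.
move=> x.
pose g s := zeta (set_coord i x s).
pose f s := partial i zeta (set_coord i x s).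
have cf : continuous f.
  move=> s; apply: continuous_comp; last exact: cdz.
  exact: continuous_set_coord.
have dg s : is_derive s (1 : R) g (f s) by apply: is_derive_set_coord; exact: dz.
have -> : (fun s => axis_slope_sup p i zeta (set_coord i x s)) = slope_sup p g.
  apply/funext => s; rewrite /axis_slope_sup set_coord_same.
  by under eq_fun do rewrite set_coord_set_coord.
rewrite ge0_integralZl//; first exact: HC.
apply/measurable_EFinP; apply: measurableT_comp (measurable_powR p) _.
by apply: measurableT_comp => //; exact: continuous_measurable_fun.
Qed.

Lemma test_function_notin A zeta x : test_function A zeta -> ~ A x ->
  zeta x = 0 /\ grad zeta x = 0.
Proof.
move=> [_ _ sA] nAx.
have zx : \forall y \near x, zeta y = 0.
  have : (~` closure [set y | zeta y != 0]) x by move=> /sA.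
  rewrite -interiorC; apply: filterS => y /= /negP.
  by rewrite negbK => /eqP.
split; first exact: nbhs_singleton zx.
apply/rowP => i; rewrite !mxE /partial.
rewrite (near_eq_derive (g := cst 0)) ?derive_cst//.
Qed.

End sections_along_axes.

(** * The Hardy inequality *)

Unset Implicit Arguments.
Unset Strict Implicit.
Set Printing Implicit Defensive.

Theorem mainTheorem3 (R : realType) (n : nat) (p r : R) (Omega : set 'rV[R]_n)
    (p_gt1 : 1 < p) (p_le_n : p <= n%:R) (r_gt0 : 0 < r)
    (domain_Omega : domain Omega) (bounded_Omega : bounded_set Omega)
    (sphere_Omega : exterior_sphere r Omega) :
  exists C : R, forall zeta : 'rV[R]_n -> R, test_function Omega zeta ->
    (\int[lebesgue_rV n]_(x in Omega)
        (`|zeta x / dist x (boundary Omega)| `^ p)%:E <=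
     C%:E * \int[lebesgue_rV n]_(x in Omega) (enorm (grad zeta x) `^ p)%:E)%E.
Proof.
have p0 : 0 < p by exact: lt_trans p_gt1.
have n0 : (0 < n)%N.
  by rewrite lt0n; apply: contraTneq p_le_n => ->; rewrite -ltNge.
have [_ _ oOmega] := domain_Omega.
have [K K0 exitK] := exterior_sphere_exit n0 r_gt0 oOmega bounded_Omega sphere_Omega.
have [C C0 HC] := @axis_slope_sup_inequality R n p p_gt1.
exists (\sum_(i < n) K `^ p * C) => zeta tz; have [sz _ _] := tz.
have [cz _] := sz [::]; rewrite /= in cz.
set I := (\int[_]_(x in Omega) (enorm _ `^ p)%:E)%E.
pose S i x := axis_slope_sup p i zeta x.
have S0 i x : (0 <= S i x)%E by exact: slope_sup_ge0.
have mS i : measurable_fun setT (S i) by exact: measurable_axis_slope_sup.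
have pointwise x : Omega x -> ((`|zeta x / dist x (boundary Omega)| `^ p)%:E <=
    \sum_(i < n) (K `^ p)%:E * S i x)%E.
  move=> Ox; have sum0 : (0 <= \sum_(i < n) (K `^ p)%:E * S i x)%E.
    by apply: sume_ge0 => i _; rewrite mule_ge0// lee_fin powR_ge0.
  have := dist_ge0 x (boundary Omega); rewrite le_eqVlt => /predU1P[<-|d0].
    (* the quotient by a zero distance is [0] *)
    by rewrite invr0 mulr0 normr0 powR0// gt_eqF.
  have [i [t [tK xt]]] := exitK _ Ox d0.
  have [zt _] := test_function_notin tz xt.
  have t0 : t != 0.
    by apply: contra_notN xt => /eqP ->; rewrite addr0 set_coord_id.
  have cg : continuous (fun s => zeta (set_coord i x s)).
    move=> s; apply: continuous_comp; last exact: cz.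
    exact: continuous_set_coord.
  have := slope_le_slope_sup (x ord0 i) p0 cg t0.
  rewrite /= zt set_coord_id sub0r normrN => hS.
  rewrite (bigD1 i)//=; apply: le_trans (leeDl _ _); last first.
    by apply: sume_ge0 => j _; rewrite mule_ge0// lee_fin powR_ge0.
  apply: le_trans (lee_wpmul2l _ hS); last by rewrite lee_fin powR_ge0.
  rewrite -EFinM lee_fin -powRM ?divr_ge0 ?(ltW K0)//.
  apply: ge0_ler_powR; rewrite ?nnegrE ?(ltW p0)//.
    by rewrite mulr_ge0 ?divr_ge0 ?(ltW K0).
  rewrite normrM normfV (gtr0_norm d0) mulrCA ler_wpM2l//.
  have nt0 : 0 < `|t| by rewrite normr_gt0.
  by rewrite ler_pdivlMr// mulrC ler_pdivrMr.
have gradI i : (\int[lebesgue_rV n]_x (`|partial i zeta x| `^ p)%:E <= I)%E.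
  rewrite /I [leRHS]integral_mkcond; apply: ge0_le_integral_nonmeasurable => x _.
    by rewrite lee_fin powR_ge0.
  rewrite patchE; case: ifPn => [_|].
    rewrite lee_fin; apply: ge0_ler_powR; rewrite ?nnegrE ?(ltW p0) ?enorm_ge0//.
    by have := normr_coord_le_enorm (grad zeta x) i; rewrite mxE.
  rewrite notin_setE => /(test_function_notin tz)[_ /rowP/(_ i)].
  by rewrite !mxE => ->; rewrite normr0 powR0// gt_eqF.
apply: (@le_trans _ _ (\int[lebesgue_rV n]_x (\sum_(i < n) (K `^ p)%:E * S i x))%E).
  rewrite integral_mkcond; apply: ge0_le_integral_nonmeasurable => x _.
    by rewrite patchE; case: ifPn => // _; rewrite lee_fin powR_ge0.
  rewrite patchE; case: ifPn => [/set_mem/pointwise//|_].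
  by apply: sume_ge0 => i _; rewrite mule_ge0// lee_fin powR_ge0.
rewrite ge0_integral_sum//; last 2 first.
- by move=> i; exact: measurable_funeM.
- by move=> i x _; rewrite mule_ge0// lee_fin powR_ge0.
rewrite -sumEFin ge0_sume_distrl; last first.
  by move=> i _; rewrite lee_fin mulr_ge0// powR_ge0.
apply: lee_sum => i _.
rewrite ge0_integralZl//; last by rewrite lee_fin powR_ge0.
rewrite EFinM -muleA; apply: lee_wpmul2l; first by rewrite lee_fin powR_ge0.
apply: le_trans (HC i zeta sz) _.
by apply: lee_wpmul2l.
Qed.
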